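(* Let $\mathcal{X}$ be a Polish space with metric $d$ and let $(\mu^\delta)_{\delta\ge0},(\mu_2^\delta)_{\delta\ge0}\subset\mathcal{P}_1(\mathcal{X})$. If $T^\delta:\mathcal{X}\to\mathcal{X}$ is an approximate transport map from $\mu^\delta$ to $\mu_2^\delta$ with degree $k$ and $\mathrm{diam}\,\mathrm{supp}\,\mu_2^\delta=O(\delta^\ell)$, then $$ W_1(\mu^\delta,\mu_2^\delta)=W_1(\mu^\delta,T^\delta_*\mu^\delta)+O(\delta^{k+\ell}). $$
   Context: $\mathcal{P}_1(\mathcal{X})$ is the set of Borel probability measures $\mu$ on $\mathcal{X}$ such that $\int_{\mathcal{X}}d(x_0,x)\,\mu(dx)<\infty$ for some $x_0\in\mathcal{X}$. $W_1$ is the 1-Wasserstein distance with cost $d$. A (family of) measurable map(s) $T^\delta:\mathcal{X}\to\mathcal{X}$ is an approximate transport from $\mu^\delta$ to $\mu_2^\delta$ with degree $k$ if $T^\delta_*\mu^\delta\ll\mu_2^\delta$ and $\sup_{x\in\mathrm{supp}\,\mu_2^\delta}\frac{d(T^\delta_*\mu^\delta)}{d\mu_2^\delta}(x)=1+O(\delta^k)$. $k,\ell$ are fixed positive exponents, and all $O(\cdot)$ are as $\delta\to0$. *)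

(* Defs.v *)
From HB Require Import structures.
From mathcomp Require Import all_boot all_order all_algebra.
From mathcomp Require Import all_classical all_reals all_analysis.
From mathcomp Require Import measurable_realfun.

Set Implicit Arguments.
Unset Strict Implicit.
Unset Printing Implicit Defensive.

Import Order.TTheory GRing.Theory Num.Theory.
Import numFieldNormedType.Exports.

Local Open Scope classical_set_scope.
Local Open Scope ring_scope.

HB.mixin Record Topological_isSeparable T & Topological T := {
  separableT : exists2 D : set T, countable D & dense D }.

#[short(type="separableType")]
HB.structure Definition Separable :=
  { T of Topological T & Topological_isSeparable T }.

HB.mixin Record Measurable_isBorel (d : measure_display) T
    & Topological T & Measurable d T := {
  measurable_borel : @measurable d T = <<s [set U : set T | open U] >> }.

#[short(type="borelType")]
HB.structure Definition Borel (d : measure_display) :=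
  { T of Topological T & Measurable d T & Measurable_isBorel d T }.

(* Complete separable metric space with its Borel sigma-algebra. The library's
   measurable spaces are pointed; this loses nothing here, as a space carrying
   a probability measure is nonempty. *)
#[short(type="polishType")]
HB.structure Definition Polish (d : measure_display) (R : numDomainType) :=
  { T of Metric R T & Complete T & Separable T & Borel d T }.

Section definitions.
Context {d : measure_display} {R : realType} {X : polishType d R}.
Local Open Scope ereal_scope.

Definition P1 : set (probability X R) :=
  [set mu | exists x0 : X, \int[mu]_x (mdist x0 x)%:E < +oo].

Definition supp (mu : probability X R) : set X :=
  [set x | forall U : set X, open_nbhs x U -> 0 < mu U].

Definition diam (A : set X) : \bar R :=
  ereal_sup [set (mdist z.1 z.2)%:E | z in A `*` A].

(* The product sigma-algebra on [X * X] is its Borel sigma-algebra, [X] being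
   separable. *)
Definition coupling (mu nu : probability X R) : set (probability (X * X)%type R) :=
  [set gamma | forall A : set X, measurable A ->
     pushforward gamma fst A = mu A /\ pushforward gamma snd A = nu A].

Definition W1 (mu nu : probability X R) : \bar R :=
  ereal_inf [set \int[gamma]_z (mdist z.1 z.2)%:E | gamma in coupling mu nu].

(* [f delta = g delta + O(delta ^ a)] as [delta] tends to 0 from the right, as an
   identity between real numbers: both sides are eventually finite. *)
Definition eqaddO_pow (f g : R -> \bar R) (a : R) : Prop :=
  exists2 e : R -> R, e =O_ (0%R^'+) (fun delta : R => delta `^ a)%R &
    \forall delta \near 0%R^'+,
      g delta \is a fin_num /\ f delta = g delta + (e delta)%:E.

(* The Radon-Nikodym derivative is only determined [mu]-almost everywhere, hence
   a pointwise supremum only makes sense for a chosen version of it. *)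
Definition RN_version (nu mu : probability X R) (rho : X -> \bar R) : Prop :=
  measurable_fun setT rho /\
  ae_eq mu setT rho (Radon_Nikodym (charge_of_finite_measure nu) mu).

Definition approximate_transport (k : R) (mu mu2 : R -> probability X R)
    (T : R -> {mfun X >-> X}) : Prop :=
  (forall delta : R, (0 <= delta)%R -> distribution (mu delta) (T delta) `<< mu2 delta) /\
  exists rho : R -> X -> \bar R,
    (forall delta : R, (0 <= delta)%R ->
       RN_version (distribution (mu delta) (T delta)) (mu2 delta) (rho delta)) /\
    eqaddO_pow (fun delta => ereal_sup (rho delta @` supp (mu2 delta)))
      (fun=> 1) k.

End definitions.

(* Main.v *)
Require Import Defs.
From HB Require Import structures.
From mathcomp Require Import all_boot all_order all_algebra.
From mathcomp Require Import all_classical all_reals all_analysis.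
From mathcomp Require Import measurable_realfun ring lra.
Import Order.TTheory GRing.Theory Num.Theory.
Import numFieldNormedType.Exports.
Local Open Scope classical_set_scope.
Local Open Scope ring_scope.

(* Let nu = T_* mu and let M = 1 + C delta^k > 1 bound the density rho of nu
   with respect to P = mu2 on the support of P, whose diameter is at most D.
   The triangle inequality W1(mu, P) <= W1(mu, nu) + W1(nu, P) would need the
   gluing lemma, but only two explicit transitions are involved:
   - P = M^-1 nu + (1 - M^-1) beta, where beta is a probability measure with
     density proportional to 1 - rho / M: from nu to P, keep the point with
     probability M^-1 and otherwise draw a new one from beta;
   - nu = (rho / M) P + (1 - M^-1) nu: from P to nu, keep the point y with
     probability rho(y) / M and otherwise draw a new one from nu.
   Both resample a mass 1 - M^-1 <= C delta^k, and move it by at most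
   D = O(delta^l), so applying them to the second marginal of a coupling
   changes its cost by at most C D delta^k. *)

(** * Borel measurability of the distance, and the support of a measure *)

Section polish_space.
Context {d : measure_display} {R : realType} {X : polishType d R}.
Implicit Types (mu : probability X R) (x y : X).

Lemma borel_open_measurable (U : set X) : open U -> measurable U.
Proof. by rewrite measurable_borel; exact: sub_gen_smallest. Qed.

Lemma exists_dense_seq :
  exists s : nat -> X, forall x (e : R), 0 < e -> exists n, mdist x (s n) < e.
Proof.
have [D /countable_injP[f finj] dD] := @separableT X.
(* The sequence inverts the injection [f] of [D] into the naturals; an index without preimage gets
   the default value [point]. *)
exists (fun n => xget point [set x | D x /\ f x = n]) => x e e0.
have [y [xy Dy]] : ((ball x e)° `&` D) !=set0.
  apply: dD; last exact: open_interior.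
  by exists x; exact: nbhsx_ballx.
exists (f y); case: xgetP => [z _ [Dz fzy]|/(_ y)]; last by case.
have -> : z = y by apply: finj => //; rewrite inE.
by move/interior_subset : xy; rewrite ballEmdist.
Qed.

Lemma measurable_mdistl x : measurable_fun [set: X] (mdist x).
Proof.
apply: (measurability _ (RGenInftyO.measurableE R)) => //.
move=> _ [_ [r ->] <-]; rewrite setTI; apply: borel_open_measurable.
rewrite openE => y /=; rewrite in_itv/= => xyr.
apply/nbhs_ballP; exists (r - mdist x y); first by rewrite /= subr_gt0.
move=> z; rewrite ballEmdist/= in_itv/= => yz.
by rewrite (le_lt_trans (metric_triangle x y z))// -ltrBrDl.
Qed.

(** Measurability is for the product sigma-algebra: by density, [mdist x y < r] holds iff some [s n]
    makes the detour from [x] to [y] through it shorter than [r]. This is a countable union of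
    sublevel sets of sums of one-variable functions. *)
Lemma measurable_mdist :
  measurable_fun [set: X * X] (fun z : X * X => mdist z.1 z.2).
Proof.
have [s sdense] := exists_dense_seq.
apply: (measurability _ (RGenInftyO.measurableE R)) => //.
move=> _ [_ [r ->] <-]; rewrite setTI.
rewrite [X in measurable X](_ : _ = \bigcup_n
    ((fun z : X * X => mdist (s n) z.1 + mdist (s n) z.2) @^-1` `]-oo, r[)).
  apply: bigcup_measurable => n _; rewrite -[X in measurable X]setTI.
  apply: measurable_funD => //;
    by apply: measurableT_comp => //; exact: measurable_mdistl.
apply/seteqP; split => -[x y]/=; rewrite ?in_itv/=.
  move=> xyr; have [|n xn] := sdense x ((r - mdist x y) / 2).
    by rewrite divr_gt0// subr_gt0.
  exists n => //=; rewrite in_itv/= metric_sym.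
  have := metric_triangle (s n) x y; rewrite (metric_sym (s n) x).
  by lra.
move=> [n _]/=; rewrite in_itv/= metric_sym; apply: le_lt_trans.
exact: metric_triangle.
Qed.

(* The complement of the support is covered by the null balls among the
   countably many of radius 1 / m centered at a dense sequence. *)
Lemma supp_null mu : measurable (supp mu) /\ mu (~` supp mu) = 0%E.
Proof.
have [s sdense] := exists_dense_seq.
pose B (n m : nat) : set X := (ball (s n) m.+1%:R^-1)°.
(* [N n m] is the ball if it is null and empty otherwise, so the union can run over all indices. *)
pose N n m := [set x | mu (B n m) = 0%E /\ B n m x].
have mB n m : measurable (B n m).
  exact/borel_open_measurable/open_interior.
have N0 n m : measurable (N n m) /\ mu (N n m) = 0%E.
  have [B0|B0] := pselect (mu (B n m) = 0%E).
    rewrite (_ : N n m = B n m)//.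
    by apply/seteqP; split => [x []//|x Bx]; split.
  by rewrite (_ : N n m = set0) ?measure0//; apply/seteqP; split => // x [].
have E : ~` supp mu = \bigcup_n \bigcup_m N n m.
  apply/seteqP; split => x.
    move=> /existsNP[U /not_implyP[[oU Ux] /negP]].
    rewrite -leNgt => U0.
    have /nbhs_ballP[e/= e0 xeU] : nbhs x U by exact: open_nbhs_nbhs.
    (* A ball of radius less than [e / 2] that contains [x] lies in the ball of radius [e] around
       [x]. *)
    have e20 : 0 < e / 2 by rewrite divr_gt0.
    have [m _ /(_ m (leqnn m))/= me] := near_infty_natSinv_lt (PosNum e20).
    have [|n xn] := sdense x (m.+1%:R^-1); first by rewrite invr_gt0.
    exists n => //; exists m => //; split.
      apply/eqP; rewrite eq_le measure_ge0 andbT (le_trans _ U0)//.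
      apply: le_measure; rewrite ?inE//.
        exact: borel_open_measurable.
      apply: subset_trans xeU.
      apply: (subset_trans (@interior_subset _ _)) => y.
      rewrite !ballEmdist/= => ny.
      have := metric_triangle x (s n) y.
      by move: me xn ny; move: (_^-1) => q; lra.
    rewrite /B /interior/=; apply/nbhs_ballP.
    exists (m.+1%:R^-1 - mdist x (s n)); first by rewrite /= subr_gt0.
    move=> y; rewrite !ballEmdist/= => ny.
    have := metric_triangle (s n) x y; rewrite (metric_sym (s n) x).
    by move: ny; move: (_^-1) => q; lra.
  move=> [n _ [m _ [B0 Bx]]] suppx.
  suff : (0%E < mu (B n m))%E by rewrite B0 ltxx.
  by apply: suppx; split => //; exact: open_interior.
have mS : measurable (~` supp mu).
  rewrite E; apply: bigcup_measurable => n _.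
  by apply: bigcup_measurable => m _; case: (N0 n m).
split; first by rewrite -(setCK (supp mu)); exact: measurableC.
apply/negligibleP => //; rewrite E.
apply: negligible_bigcup => n; apply: negligible_bigcup => m.
by have [? ?] := N0 n m; exact/negligibleP.
Qed.

End polish_space.

(** * Mixtures of laws driven by an independent uniform variable *)

Section uniform_mixture.
Context {R : realType}.
Local Open Scope ereal_scope.

Lemma exists_uniform : exists lam : probability (measurableTypeR R) R,
  forall t : R, (0 <= t <= 1)%R -> lam [set u : R | (u < t)%R] = t%:E.
Proof.
exists (uniform_prob (@ltr01 R)) => t /andP[t0 t1].
rewrite -[[set u | _]]setCK [LHS]probability_setC; last first.
  by rewrite -set_itvE; apply: measurableC; exact: measurable_itv.
rewrite [X in 1 - X](_ : _ = (1 - t)%:E) -?EFinB ?subKr//.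
rewrite /= /uniform_prob integral_uniform_pdf.
rewrite (_ : _ `&` _ = `[t, 1%R]%classic); last first.
  apply/seteqP; split => x/=; rewrite !in_itv/=.
    by move=> [/negP]; rewrite -leNgt => -> /andP[].
  move=> /andP[tx x1]; rewrite x1 (le_trans t0 tx); split => //.
  by apply/negP; rewrite -leNgt.
rewrite (eq_integral (cst 1)).
  rewrite integral_cst//= mul1e lebesgue_measure_itv/= lte_fin.
  by case: ltgtP t1 => // ->; rewrite subrr.
move=> x; rewrite inE/= in_itv/= => /andP[tx x1].
by rewrite /uniform_pdf x1 (le_trans t0 tx)/= subr0 invr1.
Qed.

(** The event is the disjoint union of two rectangles, over [f u] and over its complement. *)
Lemma product_measure_if {d d'} {X : measurableType d} {U : measurableType d'}
    (beta : probability X R) (lam : probability U R) (A B : set X)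
    (f : U -> bool) (t : R) :
  measurable A -> measurable B -> measurable [set u | f u] ->
  lam [set u | f u] = t%:E ->
  (beta \x lam) [set w | if f w.2 then A w.1 else B w.1] =
    t%:E * beta A + (1 - t)%:E * beta B.
Proof.
move=> mA mB mf lamf.
rewrite (_ : [set w | _] =
    (A `*` [set u | f u]) `|` (B `*` ~` [set u | f u])); last first.
  apply/seteqP; split => -[x u]/=.
    by case: ifPn => [|/negP] ?; [left|right].
  by case: ifPn => [|/negP] ? [[]|[]].
rewrite measureU//=;
    [|exact: measurableX|by apply: measurableX => //; exact: measurableC|].
  transitivity (beta A * lam [set u | f u] + beta B * lam (~` [set u | f u])).
    by congr (_ + _); apply: product_measure1E => //; exact: measurableC.
  by rewrite probability_setC// lamf !(muleC (beta _)).
by apply/seteqP; split => // -[x u]/= [[]? ? []].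
Qed.

(** Here [z] of law [beta] and a uniform [u] are the two coordinates of a product space. The mixture
    formula, with measurability, is all that resampling uses of them. *)
Lemma exists_randomization {d} {X : measurableType d} (beta : probability X R) :
  exists d' (V : measurableType d') (zeta : probability V R) (z : V -> X)
    (u : V -> R), [/\ measurable_fun setT z, measurable_fun setT u &
    forall (A B : set X) (t : R), measurable A -> measurable B ->
      (0 <= t <= 1)%R ->
      zeta [set v | if (u v < t)%R then A (z v) else B (z v)] =
      t%:E * beta A + (1 - t)%:E * beta B].
Proof.
have [lam lamE] := exists_uniform.
exists _, _, (beta \x lam), fst, snd; split => // A B t mA mB t01.
apply: (product_measure_if beta lam A B (fun u : R => u < t)%R t) => //.
  by rewrite -set_itvE; exact: measurable_itv.
exact: lamE.
Qed.

End uniform_mixture.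

(** * Costs of couplings *)

Section coupling_cost.
Context {d : measure_display} {R : realType} {X : polishType d R}.
Implicit Types mu nu p q beta : probability X R.
Local Open Scope ereal_scope.

Lemma W1_ge0 mu nu : 0 <= W1 mu nu.
Proof.
apply: le_ereal_inf_tmp => _ [gamma _ <-]; apply: integral_ge0 => z _.
by rewrite lee_fin mdist_ge0.
Qed.

(** The joint law of [f] and [g] is a coupling. This gives upper bounds on [W1] from random
    variables on any auxiliary space. *)
Lemma W1_le_integral {d'} {O : measurableType d'} (P : probability O R)
    mu nu (f g : O -> X) :
  measurable_fun setT f -> measurable_fun setT g ->
  (forall A, measurable A -> P (f @^-1` A) = mu A) ->
  (forall A, measurable A -> P (g @^-1` A) = nu A) ->
  W1 mu nu <= \int[P]_w (mdist (f w) (g w))%:E.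
Proof.
move=> mf mg Pf Pg; have mfg := measurable_fun_pair mf mg.
pose F : {mfun O >-> (X * X)%type} := HB.pack (fun w => (f w, g w))
  (isMeasurableFun.Build _ _ _ _ _ mfg).
apply: ereal_inf_lbound; exists (distribution P F).
  by move=> A mA; split; [exact: Pf|exact: Pg].
rewrite ge0_integral_distribution//.
  by apply/measurable_EFinP; exact: measurable_mdist.
by move=> y; rewrite lee_fin mdist_ge0.
Qed.

Lemma coupling_integral1 mu nu gamma (f : X -> \bar R) : coupling mu nu gamma ->
  measurable_fun setT f -> (forall x, 0 <= f x) ->
  \int[gamma]_z f z.1 = \int[mu]_x f x.
Proof.
move=> mng mf f0.
rewrite (eq_measure_integral (pushforward gamma fst)); last first.
  by move=> A mA _; have [H _] := mng _ mA; exact: (esym H).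
by rewrite ge0_integral_pushforward// => x _; exact: f0.
Qed.

Lemma coupling_integral2 mu nu gamma (f : X -> \bar R) : coupling mu nu gamma ->
  measurable_fun setT f -> (forall x, 0 <= f x) ->
  \int[gamma]_z f z.2 = \int[nu]_x f x.
Proof.
move=> mng mf f0.
rewrite (eq_measure_integral (pushforward gamma snd)); last first.
  by move=> A mA _; have [_ H] := mng _ mA; exact: (esym H).
by rewrite ge0_integral_pushforward// => x _; exact: f0.
Qed.

End coupling_cost.

(* The second coordinate y of a coupling of mu and p is kept with probability
   h y, i.e. if u < h y for an independent uniform variable u, and is otherwise
   replaced by an independent z of law beta. *)
Section resampling.
Context {d : measure_display} {R : realType} {X : polishType d R}.
Local Open Scope ereal_scope.
Implicit Types mu q : probability X R.
Variables (p beta : probability X R) (h : X -> R) (r : R).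
Hypotheses (mh : measurable_fun setT h) (h01 : forall x, (0 <= h x <= 1)%R).
Hypothesis hr : \int[p]_x (1 - h x)%:E = r%:E.
Context {d'} {V : measurableType d'} (zeta : probability V R).
Variables (z : V -> X) (u : V -> R).
Hypotheses (mz : measurable_fun setT z) (meas_u : measurable_fun setT u).
Hypothesis zetaE : forall (A B : set X) (t : R), measurable A -> measurable B ->
  (0 <= t <= 1)%R ->
  zeta [set v | if (u v < t)%R then A (z v) else B (z v)] =
  t%:E * beta A + (1 - t)%:E * beta B.

Let sel (w : (X * X) * V) : bool := (u w.2 < h w.1.2)%R.

(** Integrate over [zeta] first, with the coupled pair fixed. Two sets are allowed because [A = B]
    gives the law of the resampled point, while [set0] and [setT] give the probability of
    resampling. *)
Lemma resample_measure mu (gamma : probability (X * X)%type R) (A B : set X) :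
  coupling mu p gamma -> measurable A -> measurable B ->
  (gamma \x zeta) [set w | if sel w then A w.1.2 else B (z w.2)] =
  \int[p]_(x in A) (h x)%:E + r%:E * beta B.
Proof.
move=> mpg mA mB.
have h0 x : (0 <= h x)%R by have /andP[] := h01 x.
have h1 x : (0 <= 1 - h x)%R by rewrite subr_ge0; have /andP[] := h01 x.
(* [F] is the conditional probability of the event given the second coordinate. *)
pose F x := (h x * \1_A x)%:E + (1 - h x)%:E * beta B.
transitivity (\int[gamma]_v F v.2).
  rewrite /product_measure1; apply: eq_integral => v _.
  have vE : xsection [set w | if sel w then A w.1.2 else B (z w.2)] v =
      [set w | if (u w < h v.2)%R then [set _ | A v.2] (z w) else B (z w)].
    by apply/seteqP; split => w; rewrite /xsection/= inE.
  rewrite /comp vE.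
  (* With [v] fixed, the condition on a kept point is constant: as a set of values of [z] it is
     everything or nothing. *)
  have mAv : measurable [set _ : X | A v.2].
    have [Av|Av] := pselect (A v.2).
      by rewrite (_ : [set _ | _] = setT)//; apply/seteqP; split.
    by rewrite (_ : [set _ | _] = set0)//; apply/seteqP; split.
  rewrite [LHS]zetaE//.
  rewrite /F EFinM; congr (_ * _ + _).
  rewrite indicE; case: (boolP (v.2 \in A)) => [/set_mem Av|/negP Av].
    rewrite (_ : [set _ | _] = setT) ?probability_setT//.
    by apply/seteqP; split.
  rewrite (_ : [set _ | _] = set0) ?measure0//; apply/seteqP; split => // x /=.
  by move=> /mem_set.
have mhA : measurable_fun setT (fun x => (h x * \1_A x)%:E).
  by apply/measurable_EFinP; apply: measurable_funM.
have mh1 : measurable_fun setT (fun x => (1 - h x)%:E).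
  by apply/measurable_EFinP; apply: measurable_funB.
have mhB : measurable_fun setT (fun x => (1 - h x)%:E * beta B).
  by apply: emeasurable_funM.
rewrite (coupling_integral2 _ _ _ _ mpg).
- rewrite ge0_integralD//.
  + rewrite ge0_integralZr// ?hr; last by move=> x _; rewrite lee_fin.
    congr (_ + _); rewrite [RHS]integral_mkcond; apply: eq_integral => x _.
    by rewrite patchE indicE; case: ifPn => _; rewrite ?mulr1 ?mulr0.
  + by move=> x _; rewrite lee_fin mulr_ge0.
  + by move=> x _; rewrite mule_ge0// lee_fin.
- exact: emeasurable_funD.
- by move=> x; rewrite adde_ge0 ?mule_ge0// lee_fin// mulr_ge0.
Qed.

(** Resampling turns any coupling of [mu] and [p] into one of [mu] and [q]. The cost grows only on
    the resampling event, of probability [r], and there by at most [D], since the old and new points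
    almost surely lie in [S]. *)
Lemma W1_resample_randomized mu q (S : set X) (D : R) :
  (0 <= D)%R -> measurable S -> p (~` S) = 0 -> beta (~` S) = 0 ->
  (forall y z, S y -> S z -> (mdist y z <= D)%R) ->
  (forall A, measurable A ->
    q A = \int[p]_(x in A) (h x)%:E + r%:E * beta A) ->
  W1 mu q <= W1 mu p + (D * r)%:E.
Proof.
move=> D0 mS pS bS SD qE; rewrite -leeBlDr//.
apply: le_ereal_inf_tmp => _ [gamma mpg <-]; rewrite leeBlDr//.
pose P : probability (X * X * V)%type R := (gamma \x zeta).
have msel : measurable_fun setT sel.
  apply: measurable_fun_ltr => //.
    exact: measurableT_comp.
  by do 2 apply: measurableT_comp => //.
pose g (w : (X * X) * V) := if sel w then w.1.2 else z w.2.
have mg : measurable_fun setT g.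
  apply: measurable_fun_ifT => //.
    by apply: measurableT_comp.
  by apply: measurableT_comp.
have mf : measurable_fun setT
    (fun w : (X * X) * V => w.1.1).
  by apply: measurableT_comp.
have gfst A : measurable A -> gamma (fst @^-1` A) = mu A by case/mpg.
have gsnd A : measurable A -> gamma (snd @^-1` A) = p A by case/mpg.
have Pfst (A : set (X * X)) : measurable A -> P (fst @^-1` A) = gamma A.
  move=> mA; rewrite (_ : _ @^-1` _ = A `*` setT); last first.
    by apply/seteqP; split => w// [].
  transitivity (gamma A * zeta setT); first exact: product_measure1E.
  by rewrite probability_setT mule1.
have mpre (A : set X) (f : X * X -> X) : measurable_fun setT f ->
    measurable A -> measurable (f @^-1` A).
  by move=> mf' mA; rewrite -[X in measurable X]setTI; exact: mf'.
apply: (le_trans (W1_le_integral P _ _ (fun w => w.1.1) g mf mg _ _)).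
- by move=> A mA; rewrite -gfst// -Pfst//; exact: mpre.
- move=> A mA; rewrite qE//.
  rewrite -(resample_measure _ _ _ _ mpg mA mA).
  by congr (P _); apply/seteqP; split => w; rewrite /g/=; case: ifP.
pose E := [set w | ~~ sel w].
have mE : measurable E.
  rewrite (_ : E = setT `&` sel @^-1` [set false]); last first.
    apply/seteqP; split => w; first by move=> /negbTE selw; split.
    by move=> [_ selw]; exact/negbT.
  exact: msel.
have PE : P E = r%:E.
  rewrite (_ : E = [set w | if sel w then set0 w.1.2 else setT (z w.2)]).
    rewrite [LHS](resample_measure _ _ _ _ mpg)//.
    by rewrite integral_set0 add0e probability_setT mule1.
  by apply/seteqP; split => w; rewrite /E/sel/=; case: (_ < _)%R.
have mdf : measurable_fun setT (fun w : (X * X) * V =>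
    (mdist w.1.1 w.1.2)%:E).
  apply/measurable_EFinP.
  exact: (measurableT_comp measurable_mdist measurable_fst).
have mdg : measurable_fun setT (fun w => (mdist w.1.1 (g w))%:E).
  apply/measurable_EFinP.
  exact: (measurableT_comp measurable_mdist (measurable_fun_pair mf mg)).
have mDE : measurable_fun setT
    (fun w : (X * X) * V => (D * \1_E w)%:E).
  by apply/measurable_EFinP; apply: measurable_funM.
have aeS1 : {ae P, forall w, S w.1.2}.
  exists (fst @^-1` (snd @^-1` (~` S))); split => //.
  - rewrite -[X in measurable X]setTI; apply: measurable_fst => //.
    by apply: mpre => //; exact: measurableC.
  - rewrite [LHS]Pfst ?gsnd//; first exact: measurableC.
    by apply: mpre => //; exact: measurableC.
have aeS2 : {ae P, forall w, S (z w.2)}.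
  exists (setT `*` (z @^-1` (~` S))); split.
  - apply: measurableX => //; rewrite -[X in measurable X]setTI.
    by apply: mz => //; exact: measurableC.
  - transitivity (gamma setT * zeta (z @^-1` (~` S))).
      apply: product_measure1E => //; rewrite -[X in measurable X]setTI.
      by apply: mz => //; exact: measurableC.
    rewrite probability_setT mul1e.
    (* With threshold 0 and the same set in both branches, the mixture formula reduces to the law of
       [z]. *)
    have := zetaE _ _ 0%R (measurableC mS) (measurableC mS).
    rewrite lexx ler01 bS !mule0 adde0 => /(_ isT) <-.
    by congr (zeta _); apply/seteqP; split => w/=; case: ifP.
  - by move=> w/= wS; split.
apply: (@le_trans _ _
    (\int[P]_w ((mdist w.1.1 w.1.2)%:E + (D * \1_E w)%:E))).
  apply: ae_ge0_le_integral => //.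
  - by move=> w _; rewrite lee_fin mdist_ge0.
  - by move=> w _; rewrite adde_ge0// lee_fin ?mdist_ge0// mulr_ge0.
  - exact: emeasurable_funD.
  apply: filterS2 aeS1 aeS2 => w S1 S2 _; rewrite -EFinD lee_fin /g indicE.
  case: ifPn => selw.
    by rewrite lerDl mulr_ge0.
  rewrite (_ : (w \in E) = true) ?mulr1; last exact/mem_set.
  by rewrite (le_trans (metric_triangle _ w.1.2 _))// lerD2l SD.
rewrite ge0_integralD//; last 2 first.
- by move=> w _; rewrite lee_fin mdist_ge0.
- by move=> w _; rewrite lee_fin mulr_ge0.
apply: leeD.
  rewrite (eq_measure_integral (pushforward P fst)); last first.
    by move=> A mA _; exact/esym/Pfst.
  rewrite ge0_integral_pushforward//.
  - by apply/measurable_EFinP; exact: measurable_mdist.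
  - by move=> y _; rewrite lee_fin mdist_ge0.
under eq_integral do rewrite EFinM.
rewrite ge0_integralZl_EFin//; last exact/measurable_EFinP.
rewrite integral_indic// setIT EFinM; apply: lee_wpmul2l => //.
by rewrite le_eqVlt; apply/orP; left; exact/eqP.
Qed.

End resampling.

(** * Probability measures given by densities *)

Section density.
Context {d : measure_display} {R : realType} {X : measurableType d}.
Local Open Scope ereal_scope.

Lemma exists_density_probability (P : probability X R) (g : X -> R) :
  measurable_fun setT g -> (forall x, (0 <= g x)%R) ->
  \int[P]_x (g x)%:E = 1 ->
  exists beta : probability X R,
    forall A, beta A = \int[P]_(x in A) (g x)%:E.
Proof.
move=> mg g0 g1.
pose m A := \int[P]_(x in A) (g x)%:E.
have m0 : m set0 = 0 by rewrite /m integral_set0.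
have m_ge0 A : 0 <= m A by apply: integral_ge0 => x _; rewrite lee_fin.
have msigma : semi_sigma_additive m.
  apply: semi_sigma_additive_nng_induced; first exact/measurable_EFinP.
  by move=> x; rewrite lee_fin.
pose mm := isMeasure.Build _ _ _ m m0 m_ge0 msigma.
pose mM : {measure set X -> \bar R} := HB.pack m mm.
pose mP := Measure_isProbability.Build _ _ _ mM g1.
pose beta : probability X R := HB.pack m mm mP.
by exists beta.
Qed.

(** Truncating a finite version of the derivative at [M] alters it only on a null set, and makes the
    bounds hold everywhere. *)
Lemma exists_bounded_density (nu P : probability X R) (rho : X -> \bar R)
    (M : R) :
  (0 <= M)%R -> nu `<< P ->
  ae_eq P setT rho (Radon_Nikodym (charge_of_finite_measure nu) P) ->
  {ae P, forall x, rho x <= M%:E} ->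
  exists f : X -> R, [/\ measurable_fun setT f,
    forall x, (0 <= f x <= M)%R &
    forall A, measurable A -> nu A = \int[P]_(x in A) (f x)%:E].
Proof.
move=> M0 nuP rhoE rhoM.
pose f0 := Radon_Nikodym_SigmaFinite.f nu P.
have f0_ge0 : forall x, 0 <= f0 x := Radon_Nikodym_SigmaFinite.f_ge0 nuP.
have f0_fin : forall x, f0 x \is a fin_num :=
  Radon_Nikodym_SigmaFinite.f_fin_num nuP.
have mf0 : measurable_fun setT f0.
  exact: measurable_int (Radon_Nikodym_SigmaFinite.f_integrable nuP).
have f0rho := ae_eq_Radon_Nikodym_SigmaFinite nuP measurableT.
have mf : measurable_fun setT (fun x => Num.min (fine (f0 x)) M).
  by apply: measurable_minr => //; exact: measurableT_comp.
exists (fun x => Num.min (fine (f0 x)) M); split => //.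
  by move=> x; rewrite ge_min lexx orbT andbT le_min M0 fine_ge0.
move=> A mA; rewrite (Radon_Nikodym_SigmaFinite.f_integral nuP)//.
apply: ge0_ae_eq_integral => //.
- exact: measurable_funTS.
- by apply/measurable_EFinP; exact: measurable_funTS.
- by move=> x _; rewrite lee_fin le_min M0 fine_ge0.
apply: filterS3 rhoE rhoM f0rho => x rx rM f0x _.
by rewrite min_l ?fineK// -lee_fin fineK// /f0 f0x// -rx.
Qed.

End density.

(** * Stability of [W1] under a bounded density *)

Section stability.
Context {d : measure_display} {R : realType} {X : polishType d R}.
Implicit Types mu nu p q P beta : probability X R.
Local Open Scope ereal_scope.

(** The product coupling has finite cost, by the triangle inequality through [x0] and [x1]. *)
Lemma W1_lty mu nu : P1 mu -> P1 nu -> W1 mu nu < +oo.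
Proof.
move=> [x0 mux0] [x1 nux1].
have mdl x : measurable_fun setT (fun y => (mdist x y)%:E).
  by apply/measurable_EFinP; exact: measurable_mdistl.
pose P : probability (X * X)%type R := mu \x nu.
have Pc : coupling mu nu P.
  move=> A mA; split.
    rewrite /pushforward (_ : _ @^-1` _ = A `*` setT).
      by rewrite [LHS]product_measure1E// [X in _ * X]probability_setT mule1.
    by apply/seteqP; split => w// [].
  rewrite /pushforward (_ : _ @^-1` _ = setT `*` A).
    by rewrite [LHS]product_measure1E// [X in X * _]probability_setT mul1e.
  by apply/seteqP; split => w// [].
apply: (@le_lt_trans _ _ (\int[P]_z (mdist z.1 z.2)%:E)).
  by apply: ereal_inf_lbound; exists P.
pose F (z : X * X) :=
  (mdist x0 z.1)%:E + ((mdist x0 x1)%:E + (mdist x1 z.2)%:E).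
have mF1 : measurable_fun setT (fun z : X * X => (mdist x0 z.1)%:E).
  apply/measurable_EFinP.
  exact: (measurableT_comp (measurable_mdistl x0) measurable_fst).
have mF2 : measurable_fun setT
    (fun z : X * X => (mdist x0 x1)%:E + (mdist x1 z.2)%:E).
  apply: emeasurable_funD => //; apply/measurable_EFinP.
  exact: (measurableT_comp (measurable_mdistl x1) measurable_snd).
have d0 (x y : X) : 0 <= (mdist x y)%:E :> \bar R by rewrite lee_fin mdist_ge0.
apply: (@le_lt_trans _ _ (\int[P]_z F z)).
  apply: ge0_le_integral => //.
  - by apply/measurable_EFinP; exact: measurable_mdist.
  - exact: emeasurable_funD.
  move=> [x y] _; rewrite /F -!EFinD lee_fin/=.
  rewrite (le_trans (metric_triangle _ x0 _))// metric_sym lerD2l.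
  exact: metric_triangle.
rewrite ge0_integralD//; last by move=> z _; rewrite adde_ge0.
rewrite (coupling_integral2 _ _ _
  (fun y => (mdist x0 x1)%:E + (mdist x1 y)%:E) Pc)//; last 2 first.
- by apply: emeasurable_funD => //; exact: mdl.
- by move=> x; rewrite adde_ge0.
rewrite ge0_integralD//; last exact: mdl.
rewrite integral_cst// [X in _ * X]probability_setT mule1.
rewrite (coupling_integral1 _ _ _ (fun x => (mdist x0 x)%:E) Pc)//.
by apply: lte_add_pinfty => //; rewrite lte_add_pinfty// ltry.
Qed.

Lemma W1_resample mu p q beta (h : X -> R) (r : R) (S : set X) (D : R) :
  measurable_fun setT h -> (forall x, (0 <= h x <= 1)%R) ->
  \int[p]_x (1 - h x)%:E = r%:E ->
  (0 <= D)%R -> measurable S -> p (~` S) = 0 -> beta (~` S) = 0 ->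
  (forall y z, S y -> S z -> (mdist y z <= D)%R) ->
  (forall A, measurable A ->
    q A = \int[p]_(x in A) (h x)%:E + r%:E * beta A) ->
  W1 mu q <= W1 mu p + (D * r)%:E.
Proof.
move=> mh h01 hr D0 mS pS bS SD qE.
have [d' [V [zeta [z [u [mz meas_u zetaE]]]]]] := exists_randomization beta.
exact: (W1_resample_randomized p beta h r mh h01 hr zeta z u mz meas_u zetaE
  _ _ S).
Qed.

Lemma W1_density_stability mu nu P (rho : X -> \bar R) (S : set X) (D M : R) :
  (0 <= D)%R -> (1 < M)%R -> nu `<< P -> RN_version nu P rho ->
  measurable S -> P (~` S) = 0 ->
  (forall y z, S y -> S z -> (mdist y z <= D)%R) ->
  (forall x, S x -> rho x <= M%:E) ->
  W1 mu P <= W1 mu nu + (D * (1 - M^-1))%:E /\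
  W1 mu nu <= W1 mu P + (D * (1 - M^-1))%:E.
Proof.
move=> D0 M1 nuP [mrho rhoE] mS PS SD rhoM.
have M0 : (0 < M)%R := lt_trans ltr01 M1.
have mSC := measurableC mS.
have nuS : nu (~` S) = 0 by move/null_content_dominatesP : nuP; exact.
have [f [mf f0M fE]] : exists f : X -> R, [/\ measurable_fun setT f,
    forall x, (0 <= f x <= M)%R &
    forall A, measurable A -> nu A = \int[P]_(x in A) (f x)%:E].
  apply: (exists_bounded_density nu P rho M) => //; first exact: ltW.
  exists (~` S); split => // x /=; apply: contra_not => Sx; exact: rhoM.
(* The mass resampled in both directions. It is positive because [M] exceeds 1 strictly, so the
   density of [beta] below can be normalized by [r^-1]. *)
pose r : R := (1 - M^-1)%R.
have r0 : (0 < r)%R by rewrite subr_gt0 invf_lt1.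
pose h x : R := (M^-1 * f x)%R.
have mh : measurable_fun setT h by exact: measurable_funM.
have h01 x : (0 <= h x <= 1)%R.
  have /andP[f0 fM] := f0M x.
  by rewrite mulr_ge0 ?invr_ge0 ?(ltW M0)//= ler_pdivrMl// mulr1.
have h0 x : (0 <= h x)%R by have /andP[] := h01 x.
have h1 x : (0 <= 1 - h x)%R by rewrite subr_ge0; have /andP[] := h01 x.
have hE A : measurable A -> \int[P]_(x in A) (h x)%:E = (M^-1)%:E * nu A.
  move=> mA; rewrite fE//; under eq_integral do rewrite EFinM.
  rewrite ge0_integralZl_EFin//.
  - by move=> x _; rewrite lee_fin; have /andP[] := f0M x.
  - by apply/measurable_EFinP; exact: measurable_funTS.
  - by rewrite invr_ge0 ltW.
have PE A : measurable A ->
    P A = (M^-1)%:E * nu A + \int[P]_(x in A) (1 - h x)%:E.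
  move=> mA; rewrite -hE// -ge0_integralD//.
  - under eq_integral do rewrite -EFinD addrC subrK.
    by rewrite integral_cst// mul1e.
  - by move=> x _; rewrite lee_fin.
  - by apply/measurable_EFinP; exact: measurable_funTS.
  - by move=> x _; rewrite lee_fin.
  - by apply/measurable_EFinP; apply: measurable_funTS; exact: measurable_funB.
have rE : \int[P]_x (1 - h x)%:E = r%:E.
  (* On the whole space [PE] reads 1 as [M^-1] plus the integral sought. *)
  have := PE _ measurableT; rewrite !probability_setT mule1.
  case: (\int[P]_x (1 - h x)%:E) => [s| |]//= [E]; congr EFin.
  by rewrite /r [X in (X - _)%R]E addrAC subrr add0r.
(* From [P] to [nu]: keep with probability [h], otherwise draw from [nu] itself; the weights of [nu]
   add up as [M^-1 + r = 1]. *)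
split; last first.
  apply: (W1_resample _ _ _ nu h r S D) => // A mA.
  rewrite hE// -ge0_muleDl ?lee_fin ?invr_ge0 ?(ltW r0) ?(ltW M0)//.
  by rewrite -EFinD /r addrC subrK mul1e.
have mg : measurable_fun setT (fun x => (r^-1 * (1 - h x))%R).
  by apply: measurable_funM => //; exact: measurable_funB.
have gE A : measurable A ->
    \int[P]_(x in A) (r^-1 * (1 - h x))%:E =
    (r^-1)%:E * \int[P]_(x in A) (1 - h x)%:E.
  move=> mA; under eq_integral do rewrite EFinM.
  rewrite ge0_integralZl_EFin//.
  - by move=> x _; rewrite lee_fin.
  - by apply/measurable_EFinP; apply: measurable_funTS; exact: measurable_funB.
  - by rewrite invr_ge0 ltW.
have [||beta betaE] := exists_density_probability P _ mg.
- by move=> x; rewrite mulr_ge0// invr_ge0 ltW.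
- by rewrite gE// rE -EFinM mulVf// gt_eqF.
(* From [nu] to [P]: keep with constant probability [M^-1], otherwise draw from [beta]. *)
apply: (W1_resample _ _ _ beta (cst (M^-1)%R) r S D) => //.
- by move=> x /=; rewrite invr_ge0 (ltW M0) invf_le1// ltW.
- by rewrite /= integral_cst// [X in _ * X]probability_setT mule1.
- rewrite betaE; apply: null_set_integral => //.
  by apply/measurable_EFinP; exact: measurable_funTS.
move=> A mA.
have -> : \int[nu]_(x in A) (cst (M^-1)%R x)%:E = (M^-1)%:E * nu A.
  by rewrite /= integral_cst.
by rewrite PE// betaE gE// muleA -EFinM mulfV ?mul1e// gt_eqF.
Qed.

End stability.

(** * The asymptotic estimate *)

Theorem corollary2p13 (R : realType) (d : measure_display) (X : polishType d R)
    (k l : R) (mu mu2 : R -> probability X R) (T : R -> {mfun X >-> X})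
    (k_gt0 : 0 < k) (l_gt0 : 0 < l)
    (mu_P1 : forall delta : R, 0 <= delta -> P1 (mu delta))
    (mu2_P1 : forall delta : R, 0 <= delta -> P1 (mu2 delta))
    (T_transport : approximate_transport k mu mu2 T)
    (diam_supp : eqaddO_pow (fun delta => diam (supp (mu2 delta))) (fun=> 0%E) l) :
  eqaddO_pow (fun delta => W1 (mu delta) (mu2 delta))
    (fun delta => W1 (mu delta) (distribution (mu delta) (T delta))) (k + l).
Proof.
have [nu_mu2 [rho [rho_RN [e1 /eqO_exP[C1 C1_gt0 e1C] rho_sup]]]] :=
  T_transport.
have [e2 /eqO_exP[C2 C2_gt0 e2C] diamE] := diam_supp.
pose nu delta : probability X R := distribution (mu delta) (T delta).
pose e delta :=
  fine (W1 (mu delta) (mu2 delta)) - fine (W1 (mu delta) (nu delta)).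
have key : \forall delta \near 0^'+,
    [/\ W1 (mu delta) (nu delta) \is a fin_num,
        W1 (mu delta) (mu2 delta) \is a fin_num &
        `|e delta| <= (C2 * C1) * `|delta `^ (k + l)|].
  near=> delta.
  have delta_gt0 : 0 < delta by near: delta; exact: nbhs_right_gt.
  have e1M : `|e1 delta| <= C1 * `|delta `^ k| by near: delta.
  have e2M : `|e2 delta| <= C2 * `|delta `^ l| by near: delta.
  have rhoE : ereal_sup (rho delta @` supp (mu2 delta)) = (1 + (e1 delta)%:E)%E.
    by near: delta; apply: filterS rho_sup => ? [].
  have diamM : diam (supp (mu2 delta)) = (0 + (e2 delta)%:E)%E.
    by near: delta; apply: filterS diamE => ? [].
  rewrite (ger0_norm (powR_ge0 _ _)) in e1M.
  rewrite (ger0_norm (powR_ge0 _ _)) in e2M.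
  have powk : 0 < delta `^ k by exact: powR_gt0.
  have powl : 0 < delta `^ l by exact: powR_gt0.
  (* [M] uses the bound on [e1 delta] rather than [e1 delta], which may vanish, so that [M] is
     strictly above 1. *)
  pose M := 1 + C1 * delta `^ k.
  pose D := C2 * delta `^ l.
  have M1 : 1 < M by rewrite ltrDl mulr_gt0.
  have D0 : 0 <= D by rewrite mulr_ge0 ?ltW.
  have [mS PS] := supp_null (mu2 delta).
  have SD y z : supp (mu2 delta) y -> supp (mu2 delta) z -> mdist y z <= D.
    move=> Sy Sz; rewrite -lee_fin (@le_trans _ _ (diam (supp (mu2 delta))))//.
      by apply: ereal_sup_ubound; exists (y, z).
    by rewrite diamM add0e lee_fin (le_trans (ler_norm _))//.
  have rhoM x : supp (mu2 delta) x -> (rho delta x <= M%:E)%E.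
    move=> Sx.
    apply: (@le_trans _ _ (ereal_sup (rho delta @` supp (mu2 delta)))).
      by apply: ereal_sup_ubound; exists x.
    by rewrite rhoE -EFinD lee_fin lerD2l (le_trans (ler_norm _))//.
  have [H1 H2] := W1_density_stability (mu delta) (nu delta) (mu2 delta)
    (rho delta) _ D M D0 M1 (nu_mu2 _ (ltW delta_gt0))
    (rho_RN _ (ltW delta_gt0)) mS PS SD rhoM.
  have fin2 : W1 (mu delta) (mu2 delta) \is a fin_num.
    rewrite ge0_fin_numE ?W1_ge0// W1_lty//; [apply: mu_P1|apply: mu2_P1];
      exact: ltW.
  (* Finiteness is transferred from [W1 (mu delta) (mu2 delta)] by the stability bound [H2]. *)
  have fin1 : W1 (mu delta) (nu delta) \is a fin_num.
    rewrite ge0_fin_numE ?W1_ge0// (le_lt_trans H2)//.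
    by rewrite lte_add_pinfty ?ltry// ltey_eq fin2.
  split => //.
  have DM : D * (1 - M^-1) <= C2 * C1 * `|delta `^ (k + l)|.
    rewrite (ger0_norm (powR_ge0 _ _)) powRD; last first.
      by rewrite (gt_eqF delta_gt0) implybT.
    rewrite [leRHS](_ : _ = D * (M - 1)); last by rewrite /D /M; ring.
    apply: ler_wpM2l => //.
    (* This is [1 - M^-1 <= M - 1], where [M - 1] equals [C1] times the power [k] of [delta]. *)
    rewrite -subr_ge0 (_ : _ - _ = (M - 1) ^+ 2 / M).
      by rewrite divr_ge0 ?sqr_ge0// ltW// (lt_trans ltr01).
    by field; rewrite gt_eqF// (lt_trans ltr01).
  apply: le_trans DM.
  move: H1 H2; rewrite -(fineK fin1) -(fineK fin2) -!EFinD !lee_fin => H1 H2.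
  by rewrite /e ler_distl lerBlDr H1 H2.
exists e.
  apply/eqO_exP; exists (C2 * C1); first exact: mulr_gt0.
  by apply: filterS key => delta [].
apply: filterS key => delta [fin1 fin2 _]; split => //.
by rewrite /e -{1}(fineK fin2) -[X in (X + _)%E](fineK fin1) -EFinD addrC subrK.
Unshelve. all: by end_near.
Qed.
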